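(* Let $H\in(1/2,1)$, $T>0$, and let $\{B^H_t\}_{t\in[0,T]}$ be a fractional Brownian motion with Hurst index $H$, i.e. a continuous centered Gaussian process with $E(B^H_tB^H_s)=\frac12\left(t^{2H}+s^{2H}-|t-s|^{2H}\right)$, adapted to the filtration $\{\mathcal F_t\}_{t\in[0,T]}$ of a stochastic basis satisfying the usual conditions. Then for every sequence $\{\theta_n\}$ of normally condensing partitions of $[0,T]$, \[\sup_{t\in[0,T]}\big|B^H_t-A^{\theta_n}_t\big|\to 0\quad\text{in probability as } n\to\infty,\] where $A^{\theta_n}$ is the predictable compensator of the discretization of $B^H$ on $\theta_n$. That is, $B^H$ coincides with its local predictor along any sequence of normally condensing partitions, in the sense of uniform convergence in probability.
   Context: A stochastic basis $(\Omega,\mathcal F,\{\mathcal F_t\}_{t\in[0,T]},P)$ satisfies the usual conditions: the filtration is right-continuous and $\mathcal F_0$ contains all $P$-null sets of $\mathcal F_T$. For a partition $\theta$: $0=t_0^\theta<t_1^\theta<\dots<t^\theta_{k^\theta}=T$ of $[0,T]$ and an adapted process $X$ with integrable values and càdlàg paths, the predictable compensator of the discretization of $X$ on $\theta$ is the process $A^\theta_t=0$ for $0\le t<t_1^\theta$, $A^\theta_t=\sum_{j=1}^k E\big(X_{t_j^\theta}-X_{t_{j-1}^\theta}\,\big|\,\mathcal F_{t^\theta_{j-1}}\big)$ for $t_k^\theta\le t<t_{k+1}^\theta$ ($k=1,\dots,k^\theta-1$), and $A^\theta_T=\sum_{j=1}^{k^\theta}E\big(X_{t_j^\theta}-X_{t_{j-1}^\theta}\,\big|\,\mathcal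 F_{t^\theta_{j-1}}\big)$. A sequence $\{\theta_n\}$ of partitions of $[0,T]$ is normally condensing if $\theta_n\subset\theta_{n+1}$ and the mesh $|\theta_n|=\max_k(t_k^{\theta_n}-t_{k-1}^{\theta_n})\to0$. An adapted process $X$ with càdlàg paths admits a local predictor $C$ (a process with càdlàg paths) along $\{\theta_n\}$ in the sense of a convergence $\to_\tau$ if $A^{\theta_n}\to_\tau C$. *)

(* Defs.v *)
From HB Require Import structures.
From mathcomp Require Import all_boot all_order all_algebra.
From mathcomp Require Import all_classical all_reals all_analysis.
Set Implicit Arguments. Unset Strict Implicit. Unset Printing Implicit Defensive.
Import Order.TTheory GRing.Theory Num.Theory.
Import numFieldNormedType.Exports.
Local Open Scope classical_set_scope.
Local Open Scope ring_scope.

Section defs.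
Context {R : realType} {d : measure_display} {Omega : measurableType d}.
Variable P : probability Omega R.

Definition Gmeasurable (G : set (set Omega)) (f : Omega -> R) :=
  forall U : set R, measurable U -> G (f @^-1` U).

Definition usual_filtration (Tm : R) (F : R -> set (set Omega)) :=
  [/\ (forall t, 0 <= t <= Tm -> sigma_algebra setT (F t) /\ F t `<=` measurable),
      (forall s t, 0 <= s -> s <= t -> t <= Tm -> F s `<=` F t),
      (forall t, 0 <= t < Tm -> forall A, (forall s, t < s <= Tm -> F s A) -> F t A)
    &
      (forall N, F Tm N -> P N = 0%E -> F 0 N)].

Definition adapted (Tm : R) (F : R -> set (set Omega)) (X : R -> Omega -> R) :=
  forall t, 0 <= t <= Tm -> Gmeasurable (F t) (X t).

Definition centered_gaussian (X : Omega -> R) (v : R) :=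
  (v = 0 /\ {ae P, forall w, X w = 0}) \/
  (0 < v /\ forall U : set R, measurable U ->
     P (X @^-1` U) = normal_prob 0 (Num.sqrt v) U).

Definition fbm_cov (H t s : R) : R :=
  2^-1 * (t `^ (2 * H) + s `^ (2 * H) - `|t - s| `^ (2 * H)).

Definition fBm (H Tm : R) (B : R -> Omega -> R) :=
  [/\ (forall t, 0 <= t <= Tm -> measurable_fun setT (B t)),
      (forall w, {within `[0, Tm], continuous (fun t => B t w)})
    & (forall (n : nat) (ts : 'I_n -> R) (c : 'I_n -> R),
        (forall i, 0 <= ts i <= Tm) ->
        centered_gaussian (fun w => \sum_(i < n) c i * B (ts i) w)
          (\sum_(i < n) \sum_(j < n) c i * c j * fbm_cov H (ts i) (ts j)))].

Definition is_condexp (G : set (set Omega)) (X Y : Omega -> R) :=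
  [/\ Gmeasurable G Y, P.-integrable setT (EFin \o Y)
    & forall A, G A -> (\int[P]_(w in A) (Y w)%:E = \int[P]_(w in A) (X w)%:E)%E].

End defs.

Definition is_partition {R : realType} (Tm : R) (s : seq R) :=
  [/\ (1 < size s)%N, sorted <%R s, nth 0 s 0 = 0 & last 0 s = Tm].

Definition mesh {R : realType} (s : seq R) : R :=
  \big[Num.max/0]_(1 <= j < size s) (nth 0 s j - nth 0 s j.-1).

Definition normally_condensing {R : realType} (Tm : R) (theta : nat -> seq R) :=
  [/\ (forall n, is_partition Tm (theta n)),
      (forall n, {subset theta n <= theta n.+1})
    & mesh (theta n) @[n --> \oo] --> 0].

(* compensator A^theta_t built from the conditional increments Y j
   (Y j = E(X_{t_j} - X_{t_{j-1}} | F_{t_{j-1}}) for 1 <= j <= k):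
   A_t = sum of Y j over those j >= 1 with t_j <= t *)
Definition compensator {R : realType} {Omega : Type} (s : seq R)
  (Y : nat -> Omega -> R) (t : R) (w : Omega) : R :=
  \sum_(1 <= j < size s | nth 0 s j <= t) Y j w.

(* Main.v *)
Require Import Defs.
From HB Require Import structures.
From mathcomp Require Import all_boot all_order all_algebra.
From mathcomp Require Import all_classical all_reals all_analysis.
From mathcomp Require Import measurable_realfun ring lra.
Import Order.TTheory GRing.Theory Num.Theory.
Import numFieldNormedType.Exports.
Local Open Scope classical_set_scope.
Local Open Scope ring_scope.
Set Implicit Arguments.
Unset Strict Implicit.

(* At the partition points, [B - A] is (up to [B 0 = 0] a.s.) the martingale with
   increments [xi = X - E(X | F)], where [X] is an increment of [B].  Since
   [E xi^2 <= E X^2 <= C dt^(2H)] and [2H > 1], the sum of the [E xi^2] is at most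
   [C T mesh^(2H-1)], which tends to 0, and Kolmogorov's maximal inequality controls
   the martingale uniformly.  Between partition points [A] is constant and [B] moves
   by at most its modulus of continuity at the mesh, which tends to 0 pathwise. *)

(** The obstacle is integrability. A version [Y] of the conditional expectation is only known to be
    integrable, so neither [Y * xi] nor the expansion of [xi ^+ 2] is available beforehand.
    Orthogonality is therefore proved only against bounded [G]-measurable multipliers, and every use
    of it is brought to that case: by truncating [Y] in the bound on a residual, by stopping the
    sums in the maximal inequality. Only second moments of increments matter afterwards, so a crude
    multiple of the Gaussian variance suffices. The power [2 * H - 1] of the mesh is what remains
    when one factor [dt] is spent on adding up to [Tm]; for exponent [2 * H = 1] the same bound
    would not tend to 0. The supremum ranges over uncountably many times, so events are described
    through one countable family of times [g], common to all partitions. The oscillation event then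
    depends on a scale [m] but not on [n], which allows [m] to be fixed first and the mesh to be
    made small afterwards. *)

Section sub_sigma_algebra.
Context {R : realType} {d : measure_display} {Omega : measurableType d}.
Variables (P : probability Omega R) (G : set (set Omega)).
Hypotheses (sG : sigma_algebra setT G) (Gm : G `<=` measurable).

(** Moves to the measurable space generated by [G], where the closure of measurable functions under
    sums, products and indicators can be applied. The way back uses that [G], being a sigma-algebra,
    generates only itself. *)
Lemma GmeasurableP (f : Omega -> R) :
  Gmeasurable G f <-> measurable_fun [set: g_sigma_algebraType G] f.
Proof.
rewrite /Gmeasurable /measurable_fun; split => [Gf _ U mU|mf U mU].
  by rewrite setTI; apply: sub_sigma_algebra; exact: Gf.
have := mf measurableT U mU; rewrite setTI.
by rewrite /measurable/= /measurable/= sigma_algebra_id.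
Qed.

Lemma Gmeasurable_measurable_fun (f : Omega -> R) :
  Gmeasurable G f -> measurable_fun setT f.
Proof. by move=> Gf _ U mU; rewrite setTI; exact/Gm/Gf. Qed.

Lemma integrable_mul_bounded (xi Z : Omega -> R) (M : R) :
  P.-integrable setT (EFin \o xi) -> measurable_fun setT Z ->
  (forall w, `|Z w| <= M) ->
  P.-integrable setT (fun w => (Z w * xi w)%:E).
Proof.
move=> ixi mZ ZM.
apply: (@le_integrable _ _ _ P _ measurableT _ (fun w => M%:E * (xi w)%:E)%E).
- apply/measurable_EFinP/measurable_funM => //.
  exact/measurable_EFinP/(measurable_int P).
- move=> w _; rewrite -EFinM !abse_EFin lee_fin !normrM.
  by apply: ler_wpM2r => //; apply: (le_trans (ZM w)); exact: ler_norm.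
- exact: integrableZl.
Qed.

(** A bounded [Z] is within [e] of a function [Z'] taking finitely many values on sets of [G]. The
    integral of [Z' * xi] vanishes by linearity, so that of [Z * xi] is at most [e] times the first
    absolute moment of [xi], for every [e]. *)
Lemma integral_mul_bounded_eq0 (xi Z : Omega -> R) (M : R) :
  P.-integrable setT (EFin \o xi) ->
  (forall A, G A -> (\int[P]_(w in A) (xi w)%:E = 0)%E) ->
  Gmeasurable G Z -> (forall w, `|Z w| <= M) ->
  (\int[P]_w (Z w * xi w)%:E = 0)%E.
Proof.
move=> ixi xi0 GZ ZM.
have mxi : measurable_fun setT xi by exact/measurable_EFinP/(measurable_int P).
have mZ := Gmeasurable_measurable_fun GZ.
have M0 : 0 <= M by apply: le_trans (ZM point).
have iZ := integrable_mul_bounded ixi mZ ZM.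
pose I := (\int[P]_w `|(xi w)%:E|)%E.
have Ifin : I \is a fin_num.
  by rewrite ge0_fin_numE ?integral_ge0//; case/integrableP : ixi.
have key (e : R) : 0 < e -> (`|\int[P]_w (Z w * xi w)%:E| <= e%:E * I)%E.
  move=> e0.
  (* [[-M, M]] is cut into cells of width [e], and [u w] numbers the cell of [Z w]. The shift by [M]
     makes the quotient nonnegative, as truncation to [nat] requires. *)
  pose u w : nat := Num.truncn ((Z w + M) / e).
  have ux0 w : 0 <= (Z w + M) / e.
    apply: divr_ge0; last exact: ltW.
    by rewrite -lerBlDr sub0r; have := ZM w; rewrite ler_norml => /andP[].
  pose n := (Num.truncn ((M + M) / e)).+1.
  have un w : (u w < n)%N.
    rewrite ltnS; apply: le_truncn; rewrite ler_pM2r ?invr_gt0// lerD2r.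
    exact: le_trans (ler_norm _) (ZM w).
  pose A k := [set w | u w = k].
  have AG k : G (A k).
    have -> : A k = Z @^-1` `[k%:R * e - M, k.+1%:R * e - M[.
      apply/seteqP; split => w /=; rewrite in_itv/=.
        by move=> <-; rewrite lerBlDr ltrBrDr -ler_pdivlMr// -ltr_pdivrMr//
          truncn_itv.
      rewrite lerBlDr ltrBrDr -ler_pdivlMr// -ltr_pdivrMr//.
      by move=> h; apply/eqP; rewrite /u truncn_eq.
    by apply: GZ; exact: measurable_itv.
  pose c (k : nat) := k%:R * e - M.
  pose Z' w := \sum_(k < n) c k * \1_(A k) w.
  have Z'E w : Z' w = c (u w).
    rewrite /Z' (bigD1 (Ordinal (un w)))//= big1 => [|k kn].
      by rewrite addr0 indicE mem_set// mulr1.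
    rewrite indicE memNset ?mulr0// /A/= => uk.
    by move/eqP: kn; apply; apply/val_inj.
  have ZZ' w : `|Z w - Z' w| <= e.
    rewrite Z'E /c; have := truncn_itv (ux0 w).
    rewrite -/(u w) ler_pdivlMr// ltr_pdivrMr// => /andP[h1 h2].
    rewrite -natr1 mulrDl mul1r in h2.
    rewrite ler_norml; apply/andP; split; lra.
  have iA k : P.-integrable setT (fun w => (\1_(A k) w * xi w)%:E).
    apply: (@integrable_mul_bounded _ _ 1) => //.
      by apply: measurable_indic; exact/Gm.
    by move=> w; rewrite indicE; case: (_ \in _); rewrite ?normr1 ?normr0.
  have iA0 k : (\int[P]_w (\1_(A k) w * xi w)%:E = 0)%E.
    rewrite -(xi0 _ (AG k)) [RHS]integral_mkcond; apply: eq_integral => w _.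
    by rewrite patchE indicE; case: ifPn => _; rewrite ?mul1r ?mul0r.
  have iZ' : P.-integrable setT (fun w => (Z' w * xi w)%:E).
    have -> : (fun w => (Z' w * xi w)%:E) =
        (fun w => \sum_(k < n) (c k)%:E * (\1_(A k) w * xi w)%:E)%E.
      apply/funext => w; rewrite /Z' mulr_suml -sumEFin.
      by apply: eq_bigr => k _; rewrite -EFinM mulrA.
    by apply: integrable_sum => // k _; exact: integrableZl.
  have iZ'0 : (\int[P]_w (Z' w * xi w)%:E = 0)%E.
    under eq_integral.
      move=> w _; rewrite /Z' mulr_suml -sumEFin.
      under eq_bigr do rewrite -mulrA EFinM.
      over.
    rewrite integral_sum//= => [|k]; last exact: integrableZl.
    by rewrite big1// => k _; rewrite integralZl// iA0 mule0.
  have mZ' : measurable_fun setT (fun w => (Z w - Z' w) * xi w).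
    apply: measurable_funM => //; apply: measurable_funB => //; rewrite /Z'.
    apply: measurable_sum => k; apply: measurable_funM => //.
    by apply: measurable_indic; exact/Gm.
  have -> : (\int[P]_w (Z w * xi w)%:E =
      \int[P]_w ((Z w - Z' w) * xi w)%:E)%E.
    under [RHS]eq_integral do rewrite mulrBl EFinB.
    by rewrite integralB_EFin// iZ'0 sube0.
  apply: (le_trans (le_abse_integral _ _ _)) => //=; first exact/measurable_EFinP.
  rewrite /I -ge0_integralZl_EFin//; last 2 first.
  - exact/measurable_EFinP/measurableT_comp.
  - exact: ltW.
  apply: ge0_le_integral => //=.
  - exact/measurable_EFinP/measurableT_comp.
  - apply/measurable_EFinP/measurable_funM => //.
    exact: measurableT_comp.
  - by move=> w _; rewrite lee_fin normrM ler_wpM2r.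
have If : (\int[P]_w (Z w * xi w)%:E)%E \is a fin_num by exact: integrable_fin_num.
rewrite -(fineK If) -(fineK Ifin) in key *.
congr (_%:E); apply/eqP; rewrite -normr_le0; apply/ler_addgt0Pr => e e0.
have I0 : 0 <= fine I by rewrite fine_ge0// integral_ge0.
(* The [+ 1] keeps the denominator positive even when [I] is zero. *)
have := key (e / (fine I + 1)); rewrite -EFinM abse_EFin lee_fin.
rewrite divr_gt0 ?ltr_wpDl// => /(_ isT) /le_trans; apply.
by rewrite add0r -mulrAC ler_pdivrMr ?ltr_wpDl// ler_pM2l// lerDl.
Qed.

End sub_sigma_algebra.

(** * Second moments and residuals of conditional expectations *)

Section square_integrable.
Context {R : realType} {d : measure_display} {Omega : measurableType d}.
Variable P : probability Omega R.

Lemma integrable_sqr (X : Omega -> R) : measurable_fun setT X ->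
  (\int[P]_w (X w ^+ 2)%:E < +oo)%E ->
  P.-integrable setT (fun w => (X w ^+ 2)%:E).
Proof.
move=> mX X2; apply/integrableP; split.
  exact/measurable_EFinP/measurable_funX.
by under eq_integral do rewrite gee0_abs ?lee_fin ?sqr_ge0//.
Qed.

Lemma sqr_integrable_integrable (X : Omega -> R) : measurable_fun setT X ->
  (\int[P]_w (X w ^+ 2)%:E < +oo)%E -> P.-integrable setT (EFin \o X).
Proof.
move=> mX X2.
apply: (@le_integrable _ _ _ P _ measurableT _ (fun w => 1%:E + (X w ^+ 2)%:E)%E).
- exact/measurable_EFinP.
(* The domination of [|X|] by [1 + X ^+ 2] comes from [(|X| - 1) ^+ 2 >= 0]. *)
- move=> w _ /=; rewrite lee_fin (ger0_norm (addr_ge0 _ (sqr_ge0 _)))//.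
  have := sqr_ge0 (`|X w| - 1); rewrite sqrrB1 real_normK ?num_real//.
  have := normr_ge0 (X w); set x := `|_|; set y := X w ^+ 2; lra.
- apply: integrableD => //; last exact: integrable_sqr.
  exact: finite_measure_integrable_cst.
Qed.

Lemma condexp_residual_eq0 (G : set (set Omega)) (X Y : Omega -> R) :
  G `<=` measurable -> P.-integrable setT (EFin \o X) -> is_condexp P G X Y ->
  forall A, G A -> (\int[P]_(w in A) (X w - Y w)%:E = 0)%E.
Proof.
move=> Gm iX [GY iY XY] A GA; have mA := Gm _ GA.
have iXA : P.-integrable A (EFin \o X) by exact: integrableS iX.
under eq_integral do rewrite EFinB.
rewrite integralB_EFin//; last exact: integrableS iY.
by rewrite XY// subee//; exact: integrable_fin_num.
Qed.

(** On [D n], where [|Y| <= n], one has [xi ^+ 2 = X ^+ 2 - 2 * Y * xi - Y ^+ 2]. The truncated [Y]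
    is a bounded multiplier, so the cross term integrates to zero and the last term has the right
    sign. Monotone convergence in [n] removes the truncation. *)
Lemma condexp_residual_sqr_le (G : set (set Omega)) (X Y : Omega -> R) :
  sigma_algebra setT G -> G `<=` measurable ->
  measurable_fun setT X -> (\int[P]_w (X w ^+ 2)%:E < +oo)%E ->
  is_condexp P G X Y ->
  (\int[P]_w ((X w - Y w) ^+ 2)%:E <= \int[P]_w (X w ^+ 2)%:E)%E.
Proof.
move=> sG Gm mX X2 [GY iY XY].
have iX := sqr_integrable_integrable mX X2.
have mY := Gmeasurable_measurable_fun Gm GY.
pose xi w := X w - Y w.
have mxi : measurable_fun setT xi by exact: measurable_funB.
have ixi : P.-integrable setT (EFin \o xi) by exact: (integrableB measurableT iX iY).
have xi0 A : G A -> (\int[P]_(w in A) (xi w)%:E = 0)%E.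
  exact: condexp_residual_eq0.
pose D (n : nat) := [set w | `|Y w| <= n%:R].
have GD n : G (D n).
  have -> : D n = Y @^-1` `[-n%:R, n%:R].
    by apply/seteqP; split => w; rewrite /D/= in_itv/= ler_norml.
  by apply: GY; exact: measurable_itv.
have mD n : measurable (D n) by exact/Gm.
pose g n w := (xi w ^+ 2 * \1_(D n) w)%:E.
have mg n : measurable_fun setT (g n).
  apply/measurable_EFinP/measurable_funM => //.
  by apply: measurable_funX.
have g0 n w : setT w -> (0 <= g n w)%E.
  by rewrite lee_fin mulr_ge0 ?sqr_ge0.
have ndg w : setT w -> nondecreasing_seq (g^~ w).
  move=> _ n m nm; rewrite lee_fin ler_wpM2l ?sqr_ge0// !indicE ler_nat.
  case: (boolP (w \in D n)) => //; rewrite !inE /D/= => Yn.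
  by rewrite mem_set//=; apply: (le_trans Yn); rewrite ler_nat.
have gE w : setT w -> g n w @[n --> \oo] --> (xi w ^+ 2)%:E.
  move=> _; apply: cvg_near_cst; exists (Num.truncn `|Y w|).+1 => // n /= kn.
  rewrite /g indicE mem_set ?mulr1// /D/=.
  by apply: (le_trans (ltW (truncnS_gt _))); rewrite ler_nat.
have gle n : (\int[P]_w g n w <= \int[P]_w (X w ^+ 2)%:E)%E.
  pose Z w := \1_(D n) w * Y w.
  have GZ : Gmeasurable G Z.
    apply/(GmeasurableP sG)/measurable_funM; last exact/(GmeasurableP sG).
    by apply: measurable_indic; apply: sub_sigma_algebra.
  have Zn w : `|Z w| <= n%:R.
    rewrite /Z indicE; case: (boolP (w \in D n)); rewrite ?mul0r ?normr0//.
    by rewrite inE mul1r.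
  have mZ := Gmeasurable_measurable_fun Gm GZ.
  have Zxi0 := integral_mul_bounded_eq0 Gm ixi xi0 GZ Zn.
  have iZxi := integrable_mul_bounded ixi mZ Zn.
  (* Subtracting a term of integral zero turns the claim into a pointwise inequality, which holds on
     [D n] and, trivially, off it. *)
  have -> : (\int[P]_w (X w ^+ 2)%:E =
      \int[P]_w ((X w ^+ 2)%:E - (2 * (Z w * xi w))%:E))%E.
    rewrite integralB_EFin//=; last 2 first.
    - exact: integrable_sqr.
    - exact: (integrableZl measurableT 2 iZxi).
    under [X in (_ - X)%E]eq_integral do rewrite EFinM.
    by rewrite integralZl// Zxi0 mule0 sube0.
  apply: ge0_le_integral => //.
  - by move=> w _; exact: g0.
  - apply/measurable_EFinP/measurable_funB; first exact: measurable_funX.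
    by apply: measurable_funM => //; exact: measurable_funM.
  - move=> w _; rewrite -EFinB lee_fin /Z /xi indicE.
    case: (w \in D n); rewrite /= ?mul0r ?mulr1 ?mulr0 ?subr0 ?sqr_ge0//.
    rewrite mul1r; have := sqr_ge0 (Y w); set x := X w; set y := Y w.
    rewrite !expr2; nra.
have cg := @cvg_monotone_convergence _ _ _ P _ measurableT _ mg g0 ndg.
rewrite (_ : (\int[P]_w _)%E = (\int[P]_w limn (g^~ w))%E); last first.
  by apply: eq_integral => w _; apply/esym/cvg_lim => //; exact: gE.
rewrite -(cvg_lim _ cg)//; apply: lime_le; first by apply/cvg_ex; eexists; exact: cg.
exact: nearW.
Qed.

End square_integrable.

(** * Kolmogorov's maximal inequality for martingale differences *)

Section martingale_maximal_inequality.
Context {R : realType} {d : measure_display} {Omega : measurableType d}.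
Variables (P : probability Omega R) (G : nat -> set (set Omega)) (K : nat).
Variables (xi : nat -> Omega -> R) (v : nat -> R) (e : R).
Hypothesis sG : forall i, (i <= K)%N ->
  sigma_algebra setT (G i) /\ G i `<=` measurable.
Hypothesis Gmono : forall i j, (i <= j <= K)%N -> G i `<=` G j.
Hypothesis Gxi : forall i, (i < K)%N -> Gmeasurable (G i.+1) (xi i).
Hypothesis xi2 : forall i, (i < K)%N ->
  (\int[P]_w (xi i w ^+ 2)%:E <= (v i)%:E)%E.
Hypothesis xi0 : forall i, (i < K)%N -> forall A, G i A ->
  (\int[P]_(w in A) (xi i w)%:E = 0)%E.
Hypothesis e0 : 0 < e.

Let S k w := \sum_(i < k) xi i w.
Let alive k := [set w | forall i, (i <= k)%N -> `|S i w| <= e].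
(* the sums stopped at the first index where they leave [-e, e] *)
Let N k w := \sum_(i < k) \1_(alive i) w * xi i w.

Let S_measurable i k : (i <= k <= K)%N -> Gmeasurable (G k) (S i).
Proof.
move=> /andP[ik kK]; have [sGk _] := sG kK.
apply/(GmeasurableP sGk)/measurable_sum => j.
apply/(GmeasurableP sGk) => U mU; apply: (@Gmono j.+1).
  by rewrite kK (leq_trans (ltn_ord j)).
by apply: Gxi => //; exact: leq_trans (ltn_ord j) (leq_trans ik kK).
Qed.

Let alive_measurable k : (k <= K)%N -> G k (alive k).
Proof.
move=> kK; have [sGk _] := sG kK.
have -> : alive k = \bigcap_(i in [set i | (i <= k)%N]) (S i @^-1` `[- e, e]).
  by apply/seteqP; split => w h i ik; have := h i ik; rewrite /= in_itv/= ler_norml.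
rewrite -(sigma_algebra_id sGk).
apply: (@bigcap_measurable _ (g_sigma_algebraType (G k))); first by exists 0%N.
move=> i ik; apply: sub_sigma_algebra; apply: S_measurable; first exact/andP.
exact: measurable_itv.
Qed.

(** The bound is asked for [i < k] only, so that the equality still holds at the exit index itself,
    where [S k] has already left [[-e, e]]. *)
Let N_alive k w : (forall i, (i < k)%N -> `|S i w| <= e) -> N k w = S k w.
Proof.
move=> h; apply: eq_bigr => i _; rewrite indicE mem_set ?mul1r// => j ji.
by apply: h; exact: leq_ltn_trans ji (ltn_ord i).
Qed.

Let N_frozen k m w : e < `|S k w| -> (k <= m)%N -> N m w = N k w.
Proof.
move=> kw; elim: m => [|m IH]; first by rewrite leqn0 => /eqP ->.
rewrite leq_eqVlt => /predU1P[->//|km].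
rewrite /N big_ord_recr/= -/(N m w) IH// indicE memNset ?mul0r ?addr0//.
by move=> /(_ k km); rewrite leNgt kw.
Qed.

(** At the first exit index [m] the stopped sum equals [S m], and it keeps this value up to [K]. The
    maximum over all indices is thus read off at the single index [K], to which a Chebyshev estimate
    applies. *)
Let exit_gt w : ~ alive K w -> e < `|N K w|.
Proof.
move=> /existsNP[k /not_implyP[kK /negP]]; rewrite -ltNge => kw.
have exk : exists k, e < `|S k w| by exists k.
case: (ex_minnP exk) => m mw mmin.
rewrite (@N_frozen m)//; last exact: leq_trans (mmin _ kw) kK.
rewrite N_alive// => i im; rewrite leNgt; apply/negP => /mmin.
by rewrite leqNgt im.
Qed.

Let xi_measurable i : (i < K)%N -> measurable_fun setT (xi i).
Proof.
by move=> iK; apply: Gmeasurable_measurable_fun (Gxi iK); case: (sG iK).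
Qed.

Let alive_measurableT k : (k <= K)%N -> measurable (alive k).
Proof. by move=> kK; apply: (sG kK).2; exact: alive_measurable. Qed.

Let N_measurable k : (k <= K)%N -> measurable_fun setT (N k).
Proof.
move=> kK; apply: measurable_sum => i; have iK := leq_trans (ltn_ord i) kK.
apply: measurable_funM; last exact: xi_measurable.
by apply: measurable_indic; apply: alive_measurableT; exact: ltnW.
Qed.

(** Where the increment [xi k] is added, [N k] equals [S k], so the cross term of the square has the
    multiplier [Z], bounded by [e] and [G k]-measurable, and its integral vanishes. Each step then
    adds at most [v k]. *)
Let N_sqr k : (k <= K)%N ->
  (\int[P]_w (N k w ^+ 2)%:E <= (\sum_(i < k) v i)%:E)%E.
Proof.
elim: k => [_|k IH kK].
  rewrite big_ord0 integral0_eq// => w _.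
  by rewrite /N big_ord0 expr0n.
have {}IH := IH (ltnW kK).
have [sGk Gkm] := sG (ltnW kK).
have mN := N_measurable (ltnW kK); have mxi := xi_measurable kK.
have iN : P.-integrable setT (fun w => (N k w ^+ 2)%:E).
  by apply: integrable_sqr => //; exact: le_lt_trans IH (ltry _).
have ixi2 : P.-integrable setT (fun w => (xi k w ^+ 2)%:E).
  by apply: integrable_sqr => //; exact: le_lt_trans (xi2 kK) (ltry _).
have ixi : P.-integrable setT (EFin \o xi k).
  apply: sqr_integrable_integrable => //; exact: le_lt_trans (xi2 kK) (ltry _).
pose Z w := \1_(alive k) w * S k w.
have GZ : Gmeasurable (G k) Z.
  apply/(GmeasurableP sGk)/measurable_funM.
    by apply: measurable_indic; apply: sub_sigma_algebra;
      apply: alive_measurable; exact: ltnW.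
  by apply/(GmeasurableP sGk)/S_measurable; rewrite leqnn ltnW.
have Ze w : `|Z w| <= e.
  rewrite /Z indicE; case: (boolP (w \in alive k)).
    by rewrite inE => aw; rewrite mul1r; exact: aw.
  by rewrite mul0r normr0 ltW.
have mZ := Gmeasurable_measurable_fun Gkm GZ.
have iZ := integrable_mul_bounded ixi mZ Ze.
have Z0 := integral_mul_bounded_eq0 Gkm ixi (xi0 kK) GZ Ze.
have ma : measurable_fun setT (\1_(alive k) : Omega -> R).
  by apply: measurable_indic; apply: alive_measurableT; exact: ltnW.
have ia : P.-integrable setT (fun w => (\1_(alive k) w * xi k w ^+ 2)%:E).
  apply: (@integrable_mul_bounded _ _ _ _ (fun w => xi k w ^+ 2) _ 1) => //.
  by move=> w; rewrite indicE; case: (_ \in _); rewrite ?normr1 ?normr0.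
have NE w : N k.+1 w ^+ 2 =
    N k w ^+ 2 + 2 * (Z w * xi k w) + \1_(alive k) w * xi k w ^+ 2.
  rewrite /N big_ord_recr/= -/(N k w) /Z indicE.
  case: (boolP (w \in alive k)); last by rewrite !mul0r mulr0 !addr0.
  rewrite inE => aw; rewrite !mul1r -N_alive; first by ring.
  by move=> i ik; apply: aw; exact: ltnW.
have -> : (\int[P]_w (N k.+1 w ^+ 2)%:E = \int[P]_w ((N k w ^+ 2)%:E +
    2%:E * (Z w * xi k w)%:E + (\1_(alive k) w * xi k w ^+ 2)%:E))%E.
  by apply: eq_integral => w _; rewrite NE.
have i2Z : P.-integrable setT (fun w => 2%:E * (Z w * xi k w)%:E)%E.
  exact: integrableZl.
rewrite integralD//; last exact: integrableD.
rewrite integralD// integralZl// Z0 mule0 adde0.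
rewrite big_ord_recr/= EFinD leeD//.
apply: le_trans (xi2 kK); apply: ge0_le_integral => //.
- by move=> w _; rewrite lee_fin mulr_ge0 ?sqr_ge0.
- exact: (measurable_int P).
- exact: (measurable_int P).
- move=> w _; rewrite lee_fin ler_piMl ?sqr_ge0// indicE.
Qed.

Lemma measurable_martingale_maximal :
  measurable [set w | exists2 k, (k <= K)%N & e < `|\sum_(i < k) xi i w|].
Proof.
have -> : [set w | exists2 k, (k <= K)%N & e < `|\sum_(i < k) xi i w|] =
    ~` alive K.
  apply/seteqP; split => w /=.
    by move=> [k kK kw] /(_ k kK); rewrite leNgt kw.
  by move=> /existsNP[k /not_implyP[kK /negP]]; rewrite -ltNge; exists k.
exact/measurableC/alive_measurableT.
Qed.

(* Before the exit the partial sums are bounded by [e], so the cross terms of the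
   stopped sums only involve bounded multipliers of [xi]. *)
Lemma martingale_maximal_inequality :
  (P [set w | exists2 k, (k <= K)%N & (e < `|\sum_(i < k) xi i w|)%R]
   <= (e ^- 2 * \sum_(i < K) v i)%:E)%E.
Proof.
set E := [set w | _].
have mE : measurable E := measurable_martingale_maximal.
have h : ((e ^+ 2)%:E * P E <= (\sum_(i < K) v i)%:E)%E.
  apply: le_trans (N_sqr (leqnn K)).
  rewrite -[in leLHS](setIT E) -(integral_indic P measurableT mE).
  rewrite -ge0_integralZl_EFin//; last 2 first.
  - exact/measurable_EFinP/measurable_indic.
  - exact: sqr_ge0.
  apply: ge0_le_integral => //.
  - by move=> w _; rewrite -EFinM lee_fin mulr_ge0 ?sqr_ge0.
  - apply/measurable_EFinP/measurable_funM => //; exact: measurable_indic.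
  - by apply/measurable_EFinP/measurable_funX; exact: N_measurable.
  - move=> w _; rewrite -EFinM lee_fin indicE.
    case: (boolP (w \in E)); rewrite ?mulr0 ?sqr_ge0// inE => -[k kK kw].
    rewrite mulr1 -[leRHS]real_normK ?num_real// lerXn2r ?nnegrE//; first exact: ltW.
    by apply/ltW/exit_gt => /(_ k kK); rewrite leNgt kw.
rewrite -(@fineK _ (P E)) ?fin_num_measure// in h *.
by move: h; rewrite -EFinM !lee_fin ler_pdivlMl ?exprn_gt0.
Qed.

End martingale_maximal_inequality.

(** * Integration against a density, and Gaussian second moments *)

Section integral_density.
Context {R : realType} {d d' : measure_display}.
Context {Omega : measurableType d} {T : measurableType d'}.
Variables (P : {measure set Omega -> \bar R}) (mu : {measure set T -> \bar R}).
Variables (X : Omega -> T) (h : T -> R).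
Hypotheses (mX : measurable_fun setT X) (mh : measurable_fun setT h).
Hypothesis h0 : forall x, 0 <= h x.
Hypothesis PX : forall A, measurable A ->
  (P (X @^-1` A) = \int[mu]_(x in A) (h x)%:E)%E.

Import HBNNSimple.

Let integral_density_nnsfun (f : {nnsfun T >-> R}) :
  (\int[P]_w (f (X w))%:E = \int[mu]_x ((f x)%:E * (h x)%:E))%E.
Proof.
have mpre A : measurable A -> measurable (X @^-1` A).
  by move=> mA; rewrite -[_ @^-1` _]setTI; exact: mX.
under [LHS]eq_integral do rewrite fimfunE -fsumEFin//.
rewrite [LHS]ge0_integral_fsum//; last 2 first.
  - move=> r; apply/measurable_EFinP; apply: measurable_funM => //.
    by apply: (measurableT_comp _ mX); exact: measurable_indic.
  - by move=> n x _; rewrite EFinM nnfun_muleindic_ge0.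
under [RHS]eq_integral.
  move=> x _; rewrite fimfunE -fsumEFin// ge0_mule_fsuml; last first.
    by move=> r; rewrite EFinM nnfun_muleindic_ge0.
  over.
rewrite [RHS]ge0_integral_fsum//; last 2 first.
  - move=> r; apply: emeasurable_funM; last exact/measurable_EFinP.
    by apply/measurable_EFinP; apply: measurable_funM.
  - move=> n x _; rewrite mule_ge0 ?lee_fin//.
    by have := nnfun_muleindic_ge0 f n x; rewrite -EFinM lee_fin.
apply: eq_fsbigr => r _.
(* The finite sum formally ranges over all reals [r]; a negative one is never a value of [f], and
   both of its terms vanish. *)
have [r0|r0] := ltP r 0.
  rewrite preimage_nnfun0// !integral0_eq// => x _.
  - by rewrite indic0 mulr0 mul0e.
  - by rewrite indic0 mulr0.
under eq_integral do rewrite EFinM.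
rewrite ge0_integralZl_EFin//; last first.
  apply/measurable_EFinP/(measurableT_comp _ mX); exact: measurable_indic.
under [RHS]eq_integral do rewrite EFinM -muleA.
rewrite ge0_integralZl_EFin//; last 2 first.
  - by move=> x _; rewrite -EFinM lee_fin mulr_ge0.
  - apply: emeasurable_funM; last exact/measurable_EFinP.
    exact/measurable_EFinP/measurable_indic.
congr (_ * _)%E.
transitivity (P (X @^-1` (f @^-1` [set r]))).
  have := integral_indic P measurableT (mpre _ (measurable_sfunP f (measurable_set1 r))).
  by rewrite setIT => <-.
rewrite PX// integral_mkcond; apply: eq_integral => x _.
by rewrite patchE indicE; case: ifPn; rewrite ?mul1e ?mul0e.
Qed.

(** The hypothesis [PX] is the case of indicators; simple functions follow by linearity and the
    general case by monotone convergence on both sides. It is needed because [centered_gaussian]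
    speaks only of probabilities of preimages. *)
Lemma ge0_integral_density (f : T -> \bar R) :
  measurable_fun setT f -> (forall x, 0 <= f x)%E ->
  (\int[P]_w f (X w) = \int[mu]_x (f x * (h x)%:E))%E.
Proof.
move=> mf f0; pose f_ := nnsfun_approx measurableT mf.
transitivity (lim (\int[P]_w (f_ n (X w))%:E @[n --> \oo])%E).
  rewrite -monotone_convergence//=.
  - apply: eq_integral => w _; apply/esym/cvg_lim => //=.
    exact: cvg_nnsfun_approx.
  - by move=> n; apply/measurable_EFinP/(measurableT_comp _ mX).
  - by move=> n ? _; rewrite lee_fin.
  - by move=> ? _ ? ? mn; rewrite lee_fin; exact/lefP/nd_nnsfun_approx.
under eq_fun do rewrite integral_density_nnsfun.
rewrite -monotone_convergence//=.
- apply: eq_integral => x _; apply/cvg_lim => //=.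
  by apply: cvgeZr => //; exact: cvg_nnsfun_approx.
- move=> n; apply/measurable_EFinP; exact: measurable_funM.
- by move=> n x _; rewrite lee_fin mulr_ge0.
- move=> x _ m n mn; rewrite lee_fin ler_wpM2r//.
  exact/lefP/nd_nnsfun_approx.
Qed.

End integral_density.

(* [y <= exp y] at [y = x^2 / (4 s^2)] bounds the integrand by a multiple of the
   normal density with twice the variance *)
Lemma sqr_normal_pdf_le {R : realType} (s x : R) : 0 < s ->
  x ^+ 2 * normal_pdf 0 s x <=
  4 * Num.sqrt 2 * s ^+ 2 * normal_pdf 0 (Num.sqrt 2 * s) x.
Proof.
move=> s0; have r0 : 0 < Num.sqrt (2 : R) by rewrite sqrtr_gt0.
rewrite !normal_pdfE ?gt_eqF ?mulr_gt0// /normal_peak /normal_fun.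
rewrite !subr0 exprMn sqr_sqrtr//.
have -> : 2 * s ^+ 2 * pi *+ 2 = 2 * (s ^+ 2 * pi *+ 2) by rewrite mulrnAr !mulrA.
rewrite sqrtrM// invfM.
have : 0 <= (Num.sqrt (s ^+ 2 * pi *+ 2))^-1 by rewrite invr_ge0 sqrtr_ge0.
move: (Num.sqrt (s ^+ 2 * pi *+ 2))^-1 => p p0.
have s2 : 0 < s ^+ 2 by rewrite exprn_gt0.
have -> : 4 * Num.sqrt 2 * s ^+ 2 *
   ((Num.sqrt 2)^-1 * p * expR (- x ^+ 2 / (2 * s ^+ 2 *+ 2))) =
   p * (4 * s ^+ 2 * expR (- x ^+ 2 / (2 * s ^+ 2 *+ 2))).
  move: (expR _) (Num.sqrt 2) r0 => u r r0.
  by field; rewrite gt_eqF.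
rewrite mulrCA ler_wpM2l//.
set y := x ^+ 2 / (4 * s ^+ 2).
have -> : - x ^+ 2 / (2 * s ^+ 2 *+ 2) = - y.
  by rewrite /y -mulr_natl; field; rewrite gt_eqF.
have -> : - x ^+ 2 / (s ^+ 2 *+ 2) = - y + - y.
  by rewrite /y -mulr_natl; field; rewrite gt_eqF.
have -> : x ^+ 2 = 4 * s ^+ 2 * y.
  by rewrite /y; field; rewrite gt_eqF.
have : 0 < 4 * s ^+ 2 by rewrite mulr_gt0.
move: (4 * s ^+ 2) => c c0; rewrite -mulrA (ler_pM2l c0) expRD mulrA ler_piMl ?expR_ge0//.
rewrite expRN ler_pdivrMr ?expR_gt0// mul1r.
by apply: le_trans (expR_ge1Dx y); rewrite lerDr.
Qed.

(** The pointwise bound [sqr_normal_pdf_le] is integrated against a density of total mass 1. The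
    exact value would be [v]; the factor [4 * Num.sqrt 2] is the price of not computing the Gaussian
    moment. *)
Lemma centered_gaussian_sqr_le {R : realType} {d : measure_display}
    {Omega : measurableType d} (P : probability Omega R) (X : Omega -> R) (v : R) :
  measurable_fun setT X -> 0 < v -> centered_gaussian P X v ->
  (\int[P]_w (X w ^+ 2)%:E <= (4 * Num.sqrt 2 * v)%:E)%E.
Proof.
move=> mX v0 [[v0' _]|[_ PX]]; first by rewrite v0' ltxx in v0.
set s := Num.sqrt v in PX.
have s0 : 0 < s by rewrite sqrtr_gt0.
have -> : v = s ^+ 2 by rewrite sqr_sqrtr// ltW.
have mpdf t : measurable_fun setT (normal_pdf (0 : R) t).
  exact: measurable_normal_pdf.
have m2 : measurable_fun setT (fun x : R => x ^+ 2) by exact: measurable_funX.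
(* [normal_prob 0 s] unfolds to an integral of [normal_pdf 0 s], so [PX] is accepted as the density
   hypothesis. *)
rewrite (@ge0_integral_density _ _ _ _ _ P lebesgue_measure X (normal_pdf 0 s)
  mX (mpdf s) (normal_pdf_ge0 _ _) PX (fun x => (x ^+ 2)%:E)); last 2 first.
- by apply/measurable_EFinP; exact: m2.
- by move=> x; rewrite lee_fin sqr_ge0.
rewrite -[leRHS]mule1 -(integral_normal_pdf 0 (Num.sqrt 2 * s)).
rewrite -ge0_integralZl_EFin; [|by []|..]; last 3 first.
- by move=> x _; rewrite lee_fin normal_pdf_ge0.
- by apply/measurable_EFinP; exact: mpdf.
- by rewrite !mulr_ge0 ?sqr_ge0 ?sqrtr_ge0.
apply: ge0_le_integral; first by [].
- by move=> x _; rewrite -EFinM lee_fin mulr_ge0 ?sqr_ge0 ?normal_pdf_ge0.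
- by apply/measurable_EFinP; apply: measurable_funM; [exact: m2|exact: mpdf].
- apply/measurable_EFinP; apply: measurable_funM; last exact: mpdf.
  exact: measurable_cst.
- by move=> x _; rewrite -!EFinM lee_fin; exact: sqr_normal_pdf_le.
Qed.

(** * Cells and mesh of a partition *)

Section partition.
Context {R : realType}.
Variables (Tm : R) (s : seq R).
Hypothesis sP : is_partition Tm s.

Lemma partition_lt i j : (i < j < size s)%N -> nth 0 s i < nth 0 s j.
Proof.
case: sP => _ ss _ _ /andP[ij js].
by apply: (sorted_ltn_nth lt_trans) => //; rewrite inE// (ltn_trans ij).
Qed.

Lemma partition_le i j : (i <= j < size s)%N -> nth 0 s i <= nth 0 s j.
Proof.
move=> /andP[]; rewrite leq_eqVlt => /predU1P[->//|ij js].
by apply/ltW/partition_lt/andP.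
Qed.

Lemma partition_last : nth 0 s (size s).-1 = Tm.
Proof. by case: sP => _ _ _ <-; rewrite nth_last. Qed.

Lemma partition_bounds i : (i < size s)%N -> 0 <= nth 0 s i <= Tm.
Proof.
move=> i_s; have [_ _ s0 _] := sP; apply/andP; split.
  by rewrite -[leLHS]s0; apply: partition_le.
rewrite -partition_last; apply: partition_le.
by rewrite -ltnS prednK ?i_s ?leqnn// (leq_ltn_trans _ i_s).
Qed.

(** The index [k] is the largest one with a point at or before [t]. Stating maximality over all
    later [j] also covers [t = Tm], where [k] is the last index and the clause is vacuous. *)
Lemma partition_cell t : 0 <= t <= Tm ->
  exists k, [/\ (k < size s)%N, nth 0 s k <= t &
    forall j, (k < j < size s)%N -> t < nth 0 s j].
Proof.
move=> /andP[t0 tT]; have [s1 _ s0 _] := sP.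
have ex0 : exists k, (k < size s)%N && (nth 0 s k <= t).
  by exists 0%N; rewrite s0 t0 (ltnW s1).
have ub k : (k < size s)%N && (nth 0 s k <= t) -> (k <= size s)%N.
  by move=> /andP[/ltnW].
case: (ex_maxnP ex0 ub) => k /andP[ks kt] kmax.
exists k; split => // j /andP[kj js]; rewrite ltNge; apply/negP => jt.
by have := kmax j; rewrite js jt leqNgt kj => /(_ isT).
Qed.

Lemma compensator_cell (Omega : Type) (Y : nat -> Omega -> R) t k w :
  (k < size s)%N -> nth 0 s k <= t ->
  (forall j, (k < j < size s)%N -> t < nth 0 s j) ->
  compensator s Y t w = \sum_(i < k) Y i.+1 w.
Proof.
move=> ks kt kmax; rewrite /compensator.
rewrite (big_cat_nat _ (n := k.+1))//=.
rewrite [X in _ + X]big_nat_cond [X in _ + X]big1 ?addr0; last first.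
  by move=> j /andP[kj]; rewrite leNgt kmax.
rewrite big_nat_cond (eq_bigl (fun j => (1 <= j < k.+1)%N && true)); last first.
  move=> j; rewrite andbT; case: (boolP (1 <= j < k.+1)%N) => //= /andP[_ jk].
  by apply: le_trans kt; apply: partition_le; rewrite -ltnS jk.
by rewrite -big_nat_cond big_add1/= big_mkord.
Qed.

Lemma mesh_ge i : (i.+1 < size s)%N -> nth 0 s i.+1 - nth 0 s i <= mesh s.
Proof.
move=> i_s; rewrite /mesh.
by apply: (@le_bigmax_seq _ _ _ (index_iota 1 (size s)) 0 i.+1 xpredT
  (fun j => nth 0 s j - nth 0 s j.-1)); rewrite ?mem_index_iota.
Qed.

Lemma mesh_ge0 : 0 <= mesh s.
Proof.
have [s1 _ _ _] := sP; apply: le_trans (mesh_ge s1).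
by rewrite subr_ge0; apply: partition_le.
Qed.

Lemma partition_cell_mesh t k : 0 <= t <= Tm ->
  (k < size s)%N -> nth 0 s k <= t ->
  (forall j, (k < j < size s)%N -> t < nth 0 s j) ->
  `|t - nth 0 s k| <= mesh s.
Proof.
move=> /andP[t0 tT] ks kt kmax; rewrite ger0_norm ?subr_ge0//.
(* Without a next point, [k] is the last index and [t] is forced to be [Tm]. *)
have [k1|k1] := ltnP k.+1 (size s).
  by apply: le_trans (mesh_ge k1); rewrite lerD2r ltW// kmax// ltnSn.
have -> : t = nth 0 s k; last by rewrite subrr mesh_ge0.
apply/eqP; rewrite eq_le kt andbT (le_trans tT)// -partition_last.
by apply: partition_le; rewrite ks andbT -ltnS prednK// (leq_ltn_trans _ ks).
Qed.

(** Each term splits as [dt ^ (p - 1) * dt]; the first factor is at most the mesh to that power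
    since [p - 1 >= 0], and the remaining [dt] telescope to [Tm]. *)
Lemma sum_powR_le (p : R) : 1 <= p ->
  \sum_(i < (size s).-1) (nth 0 s i.+1 - nth 0 s i) `^ p <=
  mesh s `^ (p - 1) * Tm.
Proof.
move=> p1; have [s1 _ s0 _] := sP.
have -> : Tm = \sum_(i < (size s).-1) (nth 0 s i.+1 - nth 0 s i).
  rewrite -(big_mkord xpredT (fun i => nth 0 s i.+1 - nth 0 s i)).
  by rewrite telescope_sumr// partition_last s0 subr0.
rewrite mulr_sumr; apply: ler_sum => i _.
have i1 : (i.+1 < size s)%N.
  by rewrite -[ltnRHS]prednK ?ltnS ?ltn_ord// ltnW.
have x0 : 0 < nth 0 s i.+1 - nth 0 s i.
  by rewrite subr_gt0; apply: partition_lt; rewrite leqnn.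
rewrite -{1}(subrK 1 p) (powRD (r := p - 1) (s := 1)); last first.
  by rewrite (gt_eqF x0) implybT.
rewrite (powRr1 (ltW x0)) (ler_wpM2r (ltW x0))//.
by apply: ge0_ler_powR; rewrite ?subr_ge0 ?nnegrE ?mesh_ge ?mesh_ge0// ltW.
Qed.

End partition.

(** * Uniform continuity of paths and the oscillation event *)

Lemma within_continuous_unif {R : realType} (f : R -> R) (a b e : R) :
  {within `[a, b], continuous f} -> 0 < e ->
  exists2 r, 0 < r & forall s t, s \in `[a, b] -> t \in `[a, b] ->
    `|s - t| <= r -> `|f s - f t| <= e.
Proof.
move=> /subspace_continuousP cf e0.
pose Q (r x : R) := x \in `[a, b] -> forall t, t \in `[a, b] -> `|x - t| <= r ->
  `|f x - f t| <= e.
have : \forall r \near 0^'+, `[a, b] `<=` Q r.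
  apply: (compact_near_coveringP _).1; first exact: segment_compact.
  move=> x xab; have /cvgrPdist_lt/(_ (e / 2)) := cf x xab.
  rewrite divr_gt0// => /(_ isT); rewrite near_withinE => /nbhs_ballP[/= r r0 hr].
  (* With [y] within [r / 2] of [x] and [t] within [r / 2] of [y], both lie within [r] of [x], and
     [f x] is the intermediate value. *)
  exists (ball x (r / 2), [set u | u < r / 2]) => /=.
    split; first exact: nbhsx_ballx (divr_gt0 _ _).
    by apply: nbhs_right_lt; rewrite divr_gt0.
  move=> [y u] /= [yx ur] yab t tab yt.
  rewrite /ball/= in yx.
  have h1 := hr y; have h2 := hr t.
  rewrite /ball/= in h1 h2.
  have {}h1 : `|f x - f y| < e / 2.
    by apply: h1 => //; apply: (lt_trans yx); rewrite ltr_pdivrMr// ltr_pMr// ltr1n.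
  have {}h2 : `|f x - f t| < e / 2.
    apply: h2 => //; rewrite -(subrK y x) -addrA (le_lt_trans (ler_normD _ _))//.
    by rewrite [ltRHS](splitr r) ltrD// (le_lt_trans yt).
  rewrite -(subrK (f x) (f y)) -addrA (le_trans (ler_normD _ _))//.
  by rewrite [leRHS](splitr e) lerD// ltW// distrC.
move=> hQ; near (0 : R)^'+ => r.
have r0 : 0 < r by near: r; exact: nbhs_right_gt.
have hr : `[a, b] `<=` Q r by near: r.
by exists r => // s t sab tab; exact: hr.
Unshelve. all: by end_near. Qed.

(** Countability of the family [g] makes [V m] measurable. The events decrease in [m], and their
    intersection is empty because every path is uniformly continuous on [[0, Tm]]; continuity of [P]
    from above concludes. *)
Lemma oscillation_cvg0 {R : realType} {d : measure_display}
    {Omega : measurableType d} (P : probability Omega R) (Tm e : R)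
    (B : R -> Omega -> R) (g : nat -> R) :
  (forall t, 0 <= t <= Tm -> measurable_fun setT (B t)) ->
  (forall w, {within `[0, Tm], continuous (fun t => B t w)}) ->
  (forall i, 0 <= g i <= Tm) -> 0 < e ->
  let V m := [set w | exists i j, `|g i - g j| <= m.+1%:R^-1 /\
    e < `|B (g i) w - B (g j) w|] in
  (forall m, measurable (V m)) /\ P (V m) @[m --> \oo] --> 0%E.
Proof.
move=> mB cB g01 e0 V.
have mV m : measurable (V m).
  have -> : V m = \bigcup_i \bigcup_j
      [set w | `|g i - g j| <= m.+1%:R^-1 /\ e < `|B (g i) w - B (g j) w|].
    apply/seteqP; split => w.
      by move=> [i [j h]]; exists i => //; exists j.
    by move=> [i _ [j _ h]]; exists i, j.
  apply: bigcupT_measurable => i; apply: bigcupT_measurable => j.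
  have [ij|ij] := boolP (`|g i - g j| <= m.+1%:R^-1); last first.
    by rewrite (_ : [set w | _] = set0)//; apply/seteqP; split => w //= -[].
  rewrite (_ : [set w | _] =
    (fun w => `|B (g i) w - B (g j) w|) @^-1` `]e, +oo[); last first.
    by apply/seteqP; split => w /=; rewrite in_itv/= andbT => // -[].
  rewrite -[X in measurable X]setTI.
  have mf : measurable_fun setT (fun w => `|B (g i) w - B (g j) w|).
    by apply: measurableT_comp => //; apply: measurable_funB; exact: mB.
  by apply: mf => //; exact: measurable_itv.
split => //.
have V0 : \bigcap_m V m = set0.
  apply/seteqP; split => w //= Vw.
  have [r r0 hr] := within_continuous_unif (cB w) e0.
  have [i [j [h1]]] := Vw (Num.truncn r^-1) Logic.I.
  apply/negP; rewrite -leNgt; apply: hr; rewrite ?in_itv//=.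
  apply: (le_trans h1); rewrite invf_ple ?posrE ?ltr0n//.
  exact/ltW/truncnS_gt.
rewrite -(measure0 P) -V0; apply: nonincreasing_cvg_mu => //.
- by apply: (le_lt_trans (probability_le1 P (mV 0%N))); rewrite ltry.
- by rewrite V0.
- move=> m n mn; apply/subsetPset => w [i [j [h1 h2]]]; exists i, j; split => //.
  by apply: (le_trans h1); rewrite lef_pV2 ?posrE ?ltr0n// ler_nat ltnS.
Qed.

(** * Fractional Brownian motion and the error on one partition *)

Section fractional_brownian_motion.
Context {R : realType} {d : measure_display} {Omega : measurableType d}.
Variables (P : probability Omega R) (H Tm : R) (B : R -> Omega -> R).
Hypotheses (H12 : 2^-1 < H < 1) (T0 : 0 < Tm) (BH : fBm P H Tm B).

Let H0 : 2 * H != 0.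
Proof. by case/andP: H12 => h _; apply/eqP; lra. Qed.

Let fbm_cov_diag t : fbm_cov H t t = t `^ (2 * H).
Proof.
rewrite /fbm_cov (subrr t) normr0 (powR0 H0) subr0.
by move: (t `^ _) => a; field.
Qed.

(** The increment is the linear combination with coefficients 1 and -1 at the times [t] and [s]; in
    its variance the terms in [t] and [s] alone cancel and leave the power of [t - s]. *)
Lemma fBm_increment_sqr_le s t : 0 <= s -> s < t -> t <= Tm ->
  (\int[P]_w ((B t w - B s w) ^+ 2)%:E <=
   (4 * Num.sqrt 2 * (t - s) `^ (2 * H))%:E)%E.
Proof.
move=> s0 st tT; have [mB _ gB] := BH.
have t01 : 0 <= t <= Tm by rewrite (le_trans s0 (ltW st)).
have s01 : 0 <= s <= Tm by rewrite s0 (le_trans (ltW st)).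
apply: centered_gaussian_sqr_le.
- by apply: measurable_funB; exact: mB.
- by rewrite powR_gt0 // subr_gt0.
have ts0 : 0 < t - s by rewrite subr_gt0.
have ts01 (i : 'I_2) : 0 <= nth 0 [:: t; s] i <= Tm.
  by case: i => -[|[|//]].
have := gB 2%N (fun i => nth 0 [:: t; s] i) (fun i => nth 0 [:: 1; -1] i) ts01.
rewrite !big_ord_recl !big_ord0 /=.
under eq_fun do rewrite !big_ord_recl !big_ord0 /= mul1r mulN1r addr0.
rewrite !fbm_cov_diag /fbm_cov (distrC s t) (ger0_norm (ltW ts0)).
congr (centered_gaussian _ _ _).
by move: (t `^ _) (s `^ _) ((t - s) `^ _) => a b c; field.
Qed.

Let z01 : (0 : R) <= 0 <= Tm.
Proof. by apply/andP; split; [exact: lexx|exact: ltW]. Qed.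

Let measurable_start : measurable [set w | B 0 w != 0].
Proof.
have [mB _ _] := BH.
rewrite (_ : [set w | _] = B 0 @^-1` (~` [set 0])); last first.
  by apply/seteqP; split => w /= /eqP.
rewrite -[X in measurable X]setTI; apply: (mB 0 z01) => //.
by apply: measurableC; exact: measurable_set1.
Qed.

(** The variance at time 0 is 0, which selects the degenerate case of [centered_gaussian]. Paths
    starting elsewhere than 0 must be discarded, as the increments sum to [B - B 0]. *)
Lemma fBm_start0 : P [set w | B 0 w != 0] = 0%E.
Proof.
have [mB _ gB] := BH.
have := gB 1%N (fun=> 0) (fun=> 1) (fun=> z01).
rewrite !big_ord_recl !big_ord0 fbm_cov_diag (powR0 H0).
rewrite mulr0 !addr0 => -[[_ [N [mN PN sN]]]|[]]; last by rewrite ltxx.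
apply/eqP; rewrite eq_le measure_ge0 andbT -PN; apply: le_measure; rewrite ?inE//.
move=> w /= Bw; apply: sN => /=; rewrite big_ord_recl big_ord0 mul1r addr0.
exact/eqP.
Qed.

Variables (F : R -> set (set Omega)) (s : seq R) (Y : nat -> Omega -> R).
Hypotheses (FP : usual_filtration P Tm F) (BF : adapted Tm F B).
Hypothesis sP : is_partition Tm s.
Hypothesis YP : forall j, (0 < j < size s)%N ->
  is_condexp P (F (nth 0 s j.-1))
    (fun w => B (nth 0 s j) w - B (nth 0 s j.-1) w) (Y j).

(** Residuals are numbered by the left end of their cell and [Y] by the right end, hence the
    shift. *)
Let xi i w := B (nth 0 s i.+1) w - B (nth 0 s i) w - Y i.+1 w.
Let K := (size s).-1.

Let leK i : (i <= K)%N = (i < size s)%N.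
Proof. by have [s1 _ _ _] := sP; rewrite -ltnS prednK// ltnW. Qed.

Let ltK i : (i < K)%N = (i.+1 < size s)%N.
Proof. by rewrite -leK. Qed.

Lemma measurable_compensator t : 0 <= t <= Tm ->
  measurable_fun setT (compensator s Y t).
Proof.
move=> /(partition_cell sP)[k [ks kt kmax]].
rewrite (_ : compensator s Y t = (fun w => \sum_(i < k) Y i.+1 w)); last first.
  by apply/funext => w; exact: (compensator_cell sP).
apply: measurable_sum => i.
have i1 : (0 < i.+1 < size s)%N by exact: leq_ltn_trans (ltn_ord i) ks.
have [GY _ _] := YP i1; apply: Gmeasurable_measurable_fun GY.
by have [FT _ _ _] := FP; case: (FT _ (partition_bounds sP (ltnW i1))).
Qed.

Lemma discretization_maximal (e : R) : 0 < e ->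
  let M := [set w | exists2 k, (k <= K)%N & e < `|\sum_(i < k) xi i w|] in
  measurable M /\
  (P M <= (e ^- 2 * (4 * Num.sqrt 2 * (mesh s `^ (2 * H - 1) * Tm)))%:E)%E.
Proof.
move=> e0 M.
have [FT Fmono _ _] := FP; have [mB _ _] := BH.
pose G i := F (nth 0 s i).
have sG i : (i <= K)%N -> sigma_algebra setT (G i) /\ G i `<=` measurable.
  by rewrite leK => /(partition_bounds sP)/FT.
have Gmono i j : (i <= j <= K)%N -> G i `<=` G j.
  rewrite leK => /andP[ij js].
  have /andP[i0 _] := partition_bounds sP (leq_ltn_trans ij js).
  have /andP[_ jT] := partition_bounds sP js.
  by apply: Fmono => //; apply: (partition_le sP); rewrite ij.
have Gxi i : (i < K)%N -> Gmeasurable (G i.+1) (xi i).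
  rewrite ltK => i1.
  have [sGi _] : sigma_algebra setT (G i.+1) /\ G i.+1 `<=` measurable.
    by apply: sG; rewrite leK.
  have sub : G i `<=` G i.+1 by apply: Gmono; rewrite leqnSn leK.
  apply/(GmeasurableP sGi)/measurable_funB.
    apply: measurable_funB; apply/(GmeasurableP sGi).
      exact/BF/partition_bounds.
    move=> U mU; apply: sub; apply: BF => //.
    by apply: (partition_bounds sP); exact: ltnW.
  apply/(GmeasurableP sGi) => U mU; apply: sub.
  by have [GY _ _] := @YP i.+1 i1; exact: GY.
pose v i := 4 * Num.sqrt 2 * (nth 0 s i.+1 - nth 0 s i) `^ (2 * H).
have mX i : (i.+1 < size s)%N ->
    measurable_fun setT (fun w => B (nth 0 s i.+1) w - B (nth 0 s i) w).
  move=> i1; apply: measurable_funB; apply/mB/(partition_bounds sP) => //.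
  exact: ltnW.
have X2 i : (i.+1 < size s)%N ->
   (\int[P]_w ((B (nth 0 s i.+1) w - B (nth 0 s i) w) ^+ 2)%:E <= (v i)%:E)%E.
  move=> i1; apply: fBm_increment_sqr_le.
  - by have /andP[] := partition_bounds sP (ltnW i1).
  - by apply: (partition_lt sP); rewrite ltnSn.
  - by have /andP[] := partition_bounds sP i1.
have xi2 i : (i < K)%N -> (\int[P]_w (xi i w ^+ 2)%:E <= (v i)%:E)%E.
  move=> iK; have i1 : (i.+1 < size s)%N by rewrite -ltK.
  have [sGi Gm] := sG _ (ltnW iK).
  apply: le_trans (X2 _ i1).
  apply: (condexp_residual_sqr_le sGi Gm (mX _ i1)); last exact: (@YP i.+1 i1).
  by apply: le_lt_trans (X2 _ i1) _; rewrite ltry.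
have xi0 i : (i < K)%N -> forall A, G i A ->
    (\int[P]_(w in A) (xi i w)%:E = 0)%E.
  move=> iK A GA; have i1 : (i.+1 < size s)%N by rewrite -ltK.
  have [_ Gm] := sG _ (ltnW iK).
  have [GY iY YE] := @YP i.+1 i1.
  apply: (condexp_residual_eq0 (G := G i)) => //.
  apply: sqr_integrable_integrable; first exact: mX.
  by apply: le_lt_trans (X2 _ i1) _; rewrite ltry.
split; first exact: (measurable_martingale_maximal e sG Gmono Gxi).
apply: (le_trans (martingale_maximal_inequality sG Gmono Gxi xi2 xi0 e0)).
rewrite lee_fin ler_wpM2l ?invr_ge0 ?sqr_ge0//.
rewrite -mulr_sumr ler_wpM2l ?mulr_ge0 ?sqrtr_ge0//.
by apply: (sum_powR_le sP); case/andP: H12 => h _; lra.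
Qed.

(** The rationals serve to approach a time from the right inside its cell. The partition points
    supply the time [Tm], which has no such neighbour, and the left ends from which oscillations are
    measured. *)
Variables (g : nat -> R).
Hypothesis g01 : forall i, 0 <= g i <= Tm.
Hypothesis g_rat : forall q : rat, 0 <= (ratr q : R) <= Tm -> exists i, g i = ratr q.
Hypothesis g_part : forall k, (k < size s)%N -> exists i, g i = nth 0 s k.

Let E (eps : R) := [set w | (eps%:E < ereal_sup
  [set (`|B t w - compensator s Y t w|)%:E | t in `[0%R, Tm]%classic])%E].

(* [B - A] is right-continuous, so its supremum is one over a dense set *)
Let E_countable eps :
  E eps = \bigcup_i [set w | eps < `|B (g i) w - compensator s Y (g i) w|].
Proof.
apply/seteqP; split => w; last first.
  move=> [i _ /= Ei]; rewrite /E/=; apply: (@lt_le_trans _ _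
    (`|B (g i) w - compensator s Y (g i) w|)%:E); first by rewrite lte_fin.
  by apply: ereal_sup_ubound; exists (g i) => //=; rewrite in_itv/= g01.
rewrite /E/= => /ereal_sup_gt[_ [t /= + <-]]; rewrite in_itv/= lte_fin => t01 Et.
suff [i Ei] : exists i, eps < `|B (g i) w - compensator s Y (g i) w|.
  by exists i.
have [k [ks kt kmax]] := partition_cell sP t01.
have /andP[t0 tT] := t01.
have [k1|k1] := ltnP k.+1 (size s); last first.
  have [i gi] := g_part ks; exists i; rewrite gi.
  have <- : t = nth 0 s k; last by [].
  apply/eqP; rewrite eq_le kt andbT (le_trans tT)// -(partition_last sP).
  by apply: (partition_le sP); rewrite ks andbT -ltnS prednK// (leq_ltn_trans _ ks).
rewrite (compensator_cell sP Y w ks kt kmax) in Et.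
set a := \sum_(i < k) _ in Et.
have [_ cB _] := BH; have /subspace_continuousP cBw := cB w.
have e0 : 0 < `|B t w - a| - eps by rewrite subr_gt0.
have /cvgrPdist_lt/(_ _ e0) := cBw t t01.
rewrite near_withinE => /nbhs_ballP[/= r r0 hr].
have tk : t < nth 0 s k.+1 by apply: kmax; rewrite ltnSn.
(* A rational this close to the right of [t] lies in the same cell, so the compensator still has the
   value [a], while [B] has moved by less than the excess over [eps]. *)
have tm : t < Num.min (t + r) (nth 0 s k.+1) by rewrite lt_min tk ltrDl r0.
have [q] := rat_in_itvoo tm; rewrite in_itv/= lt_min => /and3P[tq qr qk].
have /andP[_ k1T] := partition_bounds sP k1.
have q01 : 0 <= (ratr q : R) <= Tm.
  by rewrite (le_trans t0 (ltW tq)) (le_trans (ltW qk) k1T).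
have [i gi] := g_rat q01; exists i; rewrite gi.
rewrite (compensator_cell sP Y w ks); last 2 first.
- exact: le_trans kt (ltW tq).
- move=> j /andP[kj js]; apply: (lt_le_trans qk).
  by apply: (partition_le sP); rewrite kj.
rewrite -/a.
have : `|B t w - B (ratr q) w| < `|B t w - a| - eps.
  apply: hr => //; rewrite /ball/= distrC ger0_norm ?subr_ge0 ?ltW//.
  by rewrite ltrBlDl.
have := ler_normD (B t w - B (ratr q) w) (B (ratr q) w - a).
rewrite addrA subrK; set x := `|_|; set y := `|_|; set z := `|_|; lra.
Qed.

Lemma measurable_discretization_error eps : measurable (E eps).
Proof.
have [mB _ _] := BH.
rewrite E_countable; apply: bigcupT_measurable => i.
rewrite (_ : [set w | _] =
  (fun w => `|B (g i) w - compensator s Y (g i) w|) @^-1` `]eps, +oo[); last first.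
  by apply/seteqP; split => w /=; rewrite in_itv/= andbT.
rewrite -[X in measurable X]setTI.
have mf : measurable_fun setT (fun w => `|B (g i) w - compensator s Y (g i) w|).
  apply: measurableT_comp => //; apply: measurable_funB; first exact: mB.
  exact: measurable_compensator.
by apply: mf => //; exact: measurable_itv.
Qed.

(** At a time [g i] whose cell starts at [g j], the error is at most the oscillation of [B] between
    the two plus the error at [g j], a partial sum of [xi] when [B 0] vanishes. One of the two must
    exceed [eps / 2]. *)
Lemma discretization_error_le (eps : R) (m : nat) : 0 < eps ->
  mesh s <= m.+1%:R^-1 ->
  (P (E eps) <= P [set w | exists i j, (`|g i - g j| <= m.+1%:R^-1)%R /\
      (eps / 2 < `|B (g i) w - B (g j) w|)%R] +
    ((eps / 2) ^- 2 * (4 * Num.sqrt 2 * (mesh s `^ (2 * H - 1) * Tm)))%:E)%E.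
Proof.
move=> eps0 sm; have [mB cB _] := BH.
have e20 : 0 < eps / 2 by rewrite divr_gt0.
have [mV _] := oscillation_cvg0 P mB cB g01 e20.
have {}mV := mV m.
set V := [set w | _] in mV *.
have [mM PM] := discretization_maximal e20.
set M := [set w | _] in mM PM.
pose Z := [set w | B 0 w != 0].
have mZ : measurable Z := measurable_start.
have EVM : E eps `<=` (V `|` M) `|` Z.
  rewrite E_countable => w [i _ /= Ei].
  have [Bw|Bw] := boolP (B 0 w != 0); [by right|left].
  move/negPn/eqP in Bw.
  have [k [ks kt kmax]] := partition_cell sP (g01 i).
  have [j gj] := g_part ks.
  have [Mw|Mw] := ltP (eps / 2) `|\sum_(i < k) xi i w|.
    by right; exists k => //; rewrite leK.
  left; exists i, j; rewrite gj; split.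
    by apply: le_trans sm; exact: (partition_cell_mesh sP).
  rewrite (compensator_cell sP Y w ks kt kmax) in Ei.
  have sumE : \sum_(i < k) xi i w = B (nth 0 s k) w - \sum_(i < k) Y i.+1 w.
    rewrite /xi sumrB; congr (_ - _).
    rewrite -(big_mkord xpredT
      (fun i => B (nth 0 s i.+1) w - B (nth 0 s i) w)).
    rewrite (telescope_sumr (fun i => B (nth 0 s i) w))//.
    by have [_ _ -> _] := sP; rewrite Bw subr0.
  rewrite sumE in Mw.
  have := ler_normD (B (g i) w - B (nth 0 s k) w)
    (B (nth 0 s k) w - \sum_(i < k) Y i.+1 w).
  rewrite addrA subrK; move: Ei Mw.
  set x := `|_|; set y := `|_|; set z := `|_|; lra.
have mE := measurable_discretization_error eps.
apply: (@le_trans _ _ (P ((V `|` M) `|` Z))).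
  apply: le_measure; rewrite ?inE//.
  by apply: measurableU => //; exact: measurableU.
have h1 : (P ((V `|` M) `|` Z) <= P (V `|` M) + P Z)%E.
  by apply: measureU2 => //; exact: measurableU.
have h2 : (P (V `|` M) <= P V + P M)%E by exact: measureU2.
rewrite (fBm_start0 : P Z = 0%E) adde0 in h1.
by apply: (le_trans h1); apply: (le_trans h2); rewrite leeD2l.
Qed.

End fractional_brownian_motion.

Theorem theorem2p1 (R : realType) (d : measure_display) (Omega : measurableType d)
  (P : probability Omega R) (H Tm : R) (F : R -> set (set Omega))
  (B : R -> Omega -> R) (theta : nat -> seq R) (Y : nat -> nat -> Omega -> R) :
  2^-1 < H < 1 -> 0 < Tm ->
  usual_filtration P Tm F -> fBm P H Tm B -> adapted Tm F B ->
  normally_condensing Tm theta ->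
  (forall n j, (0 < j < size (theta n))%N ->
     is_condexp P (F (nth 0 (theta n) j.-1))
       (fun w => B (nth 0 (theta n) j) w - B (nth 0 (theta n) j.-1) w) (Y n j)) ->
  forall eps : R, 0 < eps ->
  (fun n => P [set w | (eps%:E < ereal_sup
      [set (`|B t w - compensator (theta n) (Y n) t w|)%:E | t in `[0%R, Tm]%classic])%E])
    @ \oo --> 0%E.
Proof.
move=> H12 T0 FP BH BF [thP _ mesh0] YP eps eps0.
(* The family [g] enumerates the rationals and the points of all partitions at once, so that [V m]
   below does not depend on [n]. Codes of nothing, or of times outside [[0, Tm]], are sent to the
   harmless time 0. *)
pose h (x : rat + nat * nat) : R := match x with
  | inl q => ratr q | inr nk => nth 0 (theta nk.1) nk.2 end.
pose g i : R := if unpickle i is Some x then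
  if 0 <= h x <= Tm then h x else 0 else 0.
have g01 i : 0 <= g i <= Tm.
  have z01 : (0 : R) <= 0 <= Tm by apply/andP; split; [exact: lexx|exact: ltW].
  by rewrite /g; case: (unpickle i) => [x|//]; case: ifP.
have gh x : 0 <= h x <= Tm -> exists i, g i = h x.
  by move=> hx; exists (pickle x); rewrite /g pickleK hx.
have g_rat (q : rat) : 0 <= (ratr q : R) <= Tm -> exists i, g i = ratr q.
  exact: (gh (inl q)).
have g_part n k : (k < size (theta n))%N -> exists i, g i = nth 0 (theta n) k.
  by move=> kn; apply: (gh (inr (n, k))); exact: partition_bounds.
have [mB cB _] := BH.
have e20 : 0 < eps / 2 by rewrite divr_gt0.
pose V m := [set w | exists i j, `|g i - g j| <= m.+1%:R^-1 /\
  eps / 2 < `|B (g i) w - B (g j) w|].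
have [mV V0] : (forall m, measurable (V m)) /\ P (V m) @[m --> \oo] --> 0%E.
  exact: (oscillation_cvg0 P mB cB g01 e20).
pose E n := [set w | (eps%:E < ereal_sup
  [set (`|B t w - compensator (theta n) (Y n) t w|)%:E | t in `[0%R, Tm]])%E].
change (P (E n) @[n --> \oo] --> 0%E).
have mE n : measurable (E n).
  exact: (measurable_discretization_error BH FP (thP n) (YP n) g01 g_rat
    (g_part n)).
set c := (eps / 2) ^- 2 * (4 * Num.sqrt 2 * Tm).
have c0 : 0 <= c by rewrite !mulr_ge0 ?invr_ge0 ?sqr_ge0 ?sqrtr_ge0// ltW.
have PE n m : mesh (theta n) <= m.+1%:R^-1 ->
    (P (E n) <= P (V m) + (c * mesh (theta n) `^ (2 * H - 1))%:E)%E.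
  move=> nm; have := discretization_error_le H12 T0 BH FP BF (thP n) (YP n) g01
    g_rat (g_part n) eps0 nm.
  move=> /le_trans; apply; rewrite leeD2l// lee_fin /c.
  by rewrite [X in _ <= X](_ : _ =
    (eps / 2) ^- 2 * (4 * Num.sqrt 2 * (mesh (theta n) `^ (2 * H - 1) * Tm)));
    last by move: (_ `^ _) => p; ring.
have q0 : 0 < 2 * H - 1 by case/andP: H12 => h1 _; lra.
apply/fine_cvgP; split.
  by apply: nearW => n; rewrite fin_num_measure.
apply/cvgr0Pnorm_le => dl dl0.
(* The scale [m] is fixed before [n]; the mesh then only has to fall below [m.+1%:R^-1] and below
   the threshold that controls the martingale term. *)
have [m Vm] : exists m, fine (P (V m)) <= dl / 2.
  have /fine_cvgP[_ /cvgr0Pnorm_le/(_ (dl / 2))] := V0.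
  rewrite divr_gt0// => /(_ isT)[m _ /(_ m (leqnn m)) hm].
  by exists m; apply: le_trans hm; exact: ler_norm.
pose r := dl / 2 / (c + 1).
have r0 : 0 < r by rewrite !divr_gt0// ltr_wpDl.
(* A mesh below this threshold has its power [2 * H - 1] below [r], because the exponent is
   positive, and [c * r <= dl / 2] by the choice of [r]. *)
have r1 : 0 < r `^ (2 * H - 1)^-1 by exact: powR_gt0.
near=> n.
have mesh_n : `|mesh (theta n)| <= Num.min m.+1%:R^-1 (r `^ (2 * H - 1)^-1).
  near: n; have /cvgr0Pnorm_le := mesh0; apply.
  by rewrite lt_min r1 invr_gt0 ltr0n.
have := mesh_ge0 (thP n) => mn0.
rewrite ger0_norm// le_min in mesh_n; case/andP : mesh_n => nm nr.
have pr : mesh (theta n) `^ (2 * H - 1) <= r.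
  have -> : r = (r `^ (2 * H - 1)^-1) `^ (2 * H - 1).
    by rewrite -powRrM mulVf ?gt_eqF// powRr1// ltW.
  by apply: ge0_ler_powR => //; rewrite ?nnegrE ltW.
have hn := PE n m nm.
rewrite -(@fineK _ (P (E n))) ?fin_num_measure// in hn.
rewrite -(@fineK _ (P (V m))) ?fin_num_measure// in hn.
rewrite -EFinD lee_fin in hn.
rewrite ger0_norm ?fine_ge0//.
apply: (le_trans hn); rewrite [leRHS]splitr lerD//.
apply: (le_trans (ler_wpM2l c0 pr)).
by rewrite /r mulrCA ler_piMr ?divr_ge0 ?ltW// ltr_pdivrMr ?ltr_wpDl// mul1r ltrDl.
Unshelve. all: by end_near. Qed.
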